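(* Let $\lambda>0$. Let $(X,d_X)$ be a complete (non-extended) metric space, and let $E:X\to(-\infty,\infty]$ be bounded from below with nonempty domain $D(E)=\{E<\infty\}$. Let $Y\subset X$. Suppose that for each $y\in Y\cap D(E)$ there exists an $\mathrm{EVI}_\lambda$-flow $(\gamma^y_t)_{t>0}$ of $E$ in $(X,d_X)$ which starts from $y$, such that $\gamma^y_t\in Y$ for each $t>0$. Assume there exists $y_*\in Y$ such that $E(y_* )=\inf_{x\in X}E(x)$. Then every pair $y_1,y_2\in Y\cap D(E)$ can be connected by a curve of finite length in $Y$; that is, $d_Y(y_1,y_2)<\infty$.
   Context: Absolutely continuous curves: for a bounded interval $I$ and $p\in[1,\infty]$, $AC^p(I;(X,d_X))$ is the set of maps $\gamma:I\to X$ for which there is $m\in L^p(I)$ with $d_X(\gamma_s,\gamma_t)\le\int_s^tm(u)\,du$ for all $s<t$ in $I$; $AC:=AC^1$. The metric derivative is $|\dot\gamma|_t=\limsup_{s\to t}d_X(\gamma_s,\gamma_t)/|s-t|$. $AC^2_{\rm loc}((0,\infty);(X,d_X))$ consists of maps $\gamma:(0,\infty)\to X$ whose restriction to each bounded interval $I\subset(0,\infty)$ is in $AC^2(I;(X,d_X))$. $\mathrm{EVI}_\lambda$-flow: $\gamma\in AC^2_{\rm loc}((0,\infty);(X,d_X))$ is an $\mathrm{EVI}_\lambda$-flow of $E$ in $(X,d_X)$ if $t\mapsto E(\gamma_t)$ is lower semicontinuous and finite-valued, and for all $x\in D(E)$ and all $t>0$, $$\frac12\frac{d^+}{dt}d_X^2(\gamma_t,x)+\frac\lambda2d_X^2(\gamma_t,x)\le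 E(x)-E(\gamma_t),$$ where $d^+/dt$ is the upper right derivative. It starts from $x\in D(E)$ if $d_X(\gamma_t,x)\to0$ as $t\downarrow0$ and $\liminf_{t\downarrow0}E(\gamma_t)\ge E(x)$. Induced length metric on $Y\subset X$: $d_Y(y,y')=\inf\int_0^1|\dot\gamma|_t\,dt$ over $\gamma\in AC([0,1];(X,d_X))$ with $\gamma_t\in Y$ for all $t$, $\gamma_0=y$, $\gamma_1=y'$ ($\inf\emptyset=+\infty$). *)

(* Defs.v *)
From HB Require Import structures.
From mathcomp Require Import all_boot all_order all_algebra.
From mathcomp Require Import all_classical all_reals all_analysis.

Set Implicit Arguments.
Unset Strict Implicit.
Unset Printing Implicit Defensive.

Import Order.TTheory GRing.Theory Num.Theory.
Import numFieldNormedType.Exports.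

Local Open Scope classical_set_scope.
Local Open Scope ring_scope.
Local Open Scope ereal_scope.

#[short(type="completeMetricType")]
HB.structure Definition CompleteMetric (K : numDomainType) :=
  { M of Metric K M & Complete M }.

(* A curve on an interval I is a function on the whole line, of which only the
   values on I are used. *)

(* m \in L^p(I) is read as: the extension of m|_I by zero is in L^p(R). *)
Definition AC_on {R : realType} {X : metricType R}
    (p : \bar R) (I : interval R) (gamma : R -> X) : Prop :=
  exists m : R -> R, (m \_ [set` I])%R \in Lfun lebesgue_measure p /\
    forall s t : R, s \in I -> t \in I -> (s < t)%R ->
      (mdist (gamma s) (gamma t))%:E
        <= \int[lebesgue_measure]_(u in `[s, t]) (m u)%:E.

(* Bounded intervals may have 0 as an endpoint. *)
Definition AC2_loc_pos {R : realType} {X : metricType R} (gamma : R -> X) : Prop :=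
  forall I : interval R, bounded_set [set` I] ->
    [set` I] `<=` `]0%R, +oo[%classic -> AC_on 2%:E I gamma.

Definition metric_derivative {R : realType} {X : metricType R}
    (I : interval R) (gamma : R -> X) (t : R) : \bar R :=
  limf_esup (fun s : R => (mdist (gamma s) (gamma t) / `|s - t|)%:E)
    (within [set` I] t^').

Definition upper_right_derivative {R : realType} (f : R -> R) (t : R) : \bar R :=
  limf_esup (fun h : R => ((f (t + h)%R - f t) / h)%:E) 0^'+.

Definition edom {R : realType} {X : Type} (E : X -> \bar R) : set X :=
  [set x | E x < +oo].

Definition EVI_flow {R : realType} {X : metricType R}
    (lambda : R) (E : X -> \bar R) (gamma : R -> X) : Prop :=
  [/\ AC2_loc_pos gamma,
      lower_semicontinuous (E \o gamma : subspace `]0%R, +oo[ -> \bar R),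
      (forall t : R, (0 < t)%R -> E (gamma t) \is a fin_num) &
      forall (x : X) (t : R), edom E x -> (0 < t)%R ->
        (2^-1)%:E *
            upper_right_derivative (fun s => mdist (gamma s) x ^+ 2)%R t
          + (lambda / 2 * mdist (gamma t) x ^+ 2)%:E
        <= E x - E (gamma t)].

Definition flow_starts_from {R : realType} {X : metricType R}
    (E : X -> \bar R) (gamma : R -> X) (x : X) : Prop :=
  mdist (gamma t) x @[t --> 0^'+] --> (0 : R)%R /\
  E x <= limf_einf (E \o gamma) 0^'+.

Definition length_dist {R : realType} {X : metricType R}
    (Y : set X) (y y' : X) : \bar R :=
  ereal_inf
    [set \int[lebesgue_measure]_(t in `[0%R, 1%R])
           metric_derivative `[0%R, 1%R] gamma t
    | gamma in [set gamma : R -> X |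
        [/\ AC_on 1 `[0%R, 1%R] gamma,
            (forall t : R, t \in `[0%R, 1%R] -> Y (gamma t)),
            gamma 0%R = y & gamma 1%R = y']]].

(* Main.v *)
(* Along the flow put e = E(gamma) and psi = sqrt(e - min E). Integrating the
   EVI over [s, t], tested at gamma_s and at the minimizer y*, gives
     d(gamma_s, gamma_t)^2 <= 2 (t - s) (e_s - e_t),
     (t - s) (2 psi_t^2 + lambda d(gamma_t, y* )^2)
       <= d(gamma_s, y* )^2 - d(gamma_t, y* )^2,
   and the flow from y* itself is constant, which forces the growth
   lambda d(x, y* )^2 <= 2 (E x - min E). Eliminating t - s yields the
   Lojasiewicz-type estimate
     d(gamma_s, gamma_t) <= C (psi_s - psi_t),  C = 13 sqrt(2 / lambda).
   Hence the trajectory, reparametrized by the value of psi, is a C-Lipschitz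
   curve on [0, psi_0] from y* to the starting point; two such curves are glued
   at y*. *)

Require Import Defs.
From HB Require Import structures.
From mathcomp Require Import all_boot all_order all_algebra.
From mathcomp Require Import all_classical all_reals all_analysis.
From mathcomp Require Import measurable_realfun ring lra.

Set Implicit Arguments.
Unset Strict Implicit.
Unset Printing Implicit Defensive.

Import Order.TTheory GRing.Theory Num.Theory.
Import numFieldNormedType.Exports.

Local Open Scope classical_set_scope.
Local Open Scope ring_scope.

(** * Dini derivatives *)

(** The supremum of the points of [[a, b]] satisfying [P] satisfies [P] by [closedP], and it equals
    [b] because [stepP] would otherwise give a larger such point. One later point is enough for the
    step, so [P] need not hold on a whole interval. *)
Lemma real_induction (R : realType) (P : R -> Prop) (a b : R) :
  a <= b -> P a ->
  (forall c, a < c <= b ->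
    (forall e, 0 < e -> exists2 x, c - e < x <= c & P x) -> P c) ->
  (forall c, a <= c < b -> P c -> exists2 x, c < x <= b & P x) ->
  P b.
Proof.
move=> ab Pa closedP stepP.
pose S := [set x | a <= x <= b /\ P x].
have Sa : S a by rewrite /S/= lexx ab.
have Sb : ubound S b by move=> x [/andP[]].
have supS : has_sup S by split; [exists a | exists b].
have a_sup : a <= sup S by apply: ub_le_sup => //; exists b.
have sup_b : sup S <= b by apply: ge_sup => //; exists a.
have Psup : P (sup S).
  move: a_sup; rewrite le_eqVlt => /predU1P[<-//|a_sup].
  apply: closedP => [|e e0]; first by rewrite a_sup.
  have [x Sx xe] := sup_adherent e0 supS; exists x; last exact: Sx.2.
  by rewrite xe; apply: ub_le_sup => //; exists b.
move: sup_b; rewrite le_eqVlt => /predU1P[<-//|sup_b].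
have [|x /andP[supx xb] Px] := stepP (sup S) _ Psup; first by rewrite a_sup.
suff : x <= sup S by rewrite leNgt supx.
apply: ub_le_sup; first by exists b.
by split=> //; rewrite xb (le_trans a_sup (ltW supx)).
Qed.

Lemma upper_right_derivative_lt (R : realType) (f : R -> R) (t K K' : R) :
  (upper_right_derivative f t <= K%:E)%E -> K < K' ->
  \forall h \near 0^'+, f (t + h) - f t < K' * h.
Proof.
move=> fK KK'; have : (upper_right_derivative f t < K'%:E)%E.
  by rewrite (le_lt_trans fK)// lte_fin.
move=> /ereal_inf_lt[_ [V V0 <-] supV].
near=> h; have h0 : 0 < h by near: h; exact: nbhs_right_gt.
rewrite -ltr_pdivrMr// -lte_fin; apply: le_lt_trans supV.
by apply: ereal_sup_ubound; exists h => //; near: h.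
Unshelve. all: by end_near. Qed.

(** Real induction for each slope [K' > K]: the slack turns the bound on the upper derivative into a
    genuine increment bound just to the right of [c], and continuity handles limits from the left.
    Then [K'] decreases to [K]. *)
Lemma dini_le (R : realType) (f : R -> R) (a b K : R) : a <= b ->
  (forall c, a <= c <= b -> f x @[x --> c] --> f c) ->
  (forall c, a <= c < b -> (upper_right_derivative f c <= K%:E)%E) ->
  f b - f a <= K * (b - a).
Proof.
move=> ab cf fK.
suff H K' : K < K' -> f b - f a <= K' * (b - a).
  move: ab; rewrite le_eqVlt => /predU1P[->|ab]; first by rewrite !subrr mulr0.
  rewrite -ler_pdivrMr ?subr_gt0//; apply/ler_addgt0Pr => e e0.
  by rewrite ler_pdivrMr ?subr_gt0// H// ltrDl.
move=> KK'.
apply: (@real_induction R (fun x => f x - f a <= K' * (x - a)) a b) => //.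
- by rewrite !subrr mulr0.
- move=> c /andP[ac cb] cl; rewrite leNgt; apply/negP; rewrite -subr_gt0 => gc0.
  have gc : f x - f a - K' * (x - a) @[x --> c] --> f c - f a - K' * (c - a).
    apply: cvgB; first by apply: cvgB; [apply: cf; rewrite (ltW ac)|exact: cvg_cst].
    by apply: cvgM; [exact: cvg_cst|apply: cvgB; [exact: cvg_id|exact: cvg_cst]].
  have : \forall x \near c, 0 < f x - f a - K' * (x - a) by exact: cvgr_gt gc _ gc0.
  move=> /nbhs_ballP[e /= e0 ce].
  have [x /andP[cx xc] Px] := cl _ e0.
  have : 0 < f x - f a - K' * (x - a).
    by apply: ce; rewrite /ball/= ger0_norm ?subr_ge0//; lra.
  by rewrite subr_gt0 ltNge Px.
- move=> c acb Pc; have /andP[ac cb] := acb.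
  have H := upper_right_derivative_lt (fK _ acb) KK'.
  have : \forall h \near 0^'+, [/\ 0 < h, h <= b - c & f (c + h) - f c < K' * h].
    near=> h; split; near: h => //; first exact: nbhs_right_gt.
    by apply: nbhs_right_le; rewrite subr_gt0.
  move=> /filter_ex[h [h0 hb fh]]; exists (c + h); first by lra.
  have -> : K' * (c + h - a) = K' * (c - a) + K' * h by ring.
  lra.
Unshelve. all: by end_near. Qed.

(** * Continuity of curves with square integrable speed *)

(** A substitute for the Cauchy-Schwarz inequality: [M] is the squared L^2 norm of the speed bound
    extended by zero, and [e] is a free parameter. Choosing first [e], then [t - s] small makes the
    bound small. *)
Lemma AC_on2_integral_le (R : realType) (X : metricType R) (I : interval R)
    (gamma : R -> X) : AC_on 2%:E I gamma ->
  exists2 M : R, 0 <= M & forall e s t, 0 < e -> s \in I -> t \in I -> s < t ->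
    mdist (gamma s) (gamma t) <= e * M + (t - s) / e.
Proof.
move=> [m [mL2 dm]]; pose w : R -> R := m \_ [set` I].
rewrite -/w in mL2.
have wm : measurable_fun setT w.
  by have := sub_Lfun_mfun mL2; rewrite inE/=.
have wi := Lfun2_integrable_sqr mL2.
have w2fin : (\int[lebesgue_measure]_u (w u ^+ 2)%:E \is a fin_num)%E.
  exact: integrable_fin_num wi.
exists (fine (\int[lebesgue_measure]_u (w u ^+ 2)%:E)).
  by apply/fine_ge0/integral_ge0 => x _; rewrite lee_fin sqr_ge0.
move=> e s t e0 sI tI st; rewrite -lee_fin; apply: le_trans (dm _ _ sI tI st) _.
have sub : `[s, t] `<=` [set` I] by apply: interval_is_interval.
have -> : (\int[lebesgue_measure]_(u in `[s, t]) (m u)%:E =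
           \int[lebesgue_measure]_(u in `[s, t]) (w u)%:E)%E.
  by apply: eq_integral => u; rewrite inE => /sub uI; rewrite /w patchE mem_set.
have mst : measurable (`[s, t] : set R) by exact: measurable_itv.
have wmst : measurable_fun `[s, t] w by exact: measurable_funTS.
have wem : measurable_fun `[s, t] (fun u => (w u)%:E) by exact/measurable_EFinP.
apply: (le_trans (lee_abs _)).
apply: (le_trans (le_abse_integral lebesgue_measure mst wem)).
have w2m : measurable_fun `[s, t] (fun u => (e * w u ^+ 2)%:E).
  apply/measurable_EFinP; apply: measurable_funM; first exact: measurable_cst.
  exact: measurable_funX.
apply: (@le_trans _ _ (\int[lebesgue_measure]_(u in `[s, t])
    ((e * w u ^+ 2)%:E + (e^-1)%:E))%E).
  apply: ge0_le_integral => //.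
  - by apply: measurableT_comp.
  - by apply: emeasurable_funD => //; exact: measurable_cst.
  - move=> u _ /=; rewrite lee_fin.
    (* Young: [`|w| <= e * w ^+ 2 + e^-1] *)
    rewrite -[w u ^+ 2]real_normK ?num_real//; move: (normr_ge0 (w u)).
    move: `|w u| => a a0; rewrite -(ler_pM2l e0) mulrDr divff ?gt_eqF//.
    have := sqr_ge0 (e * a - 1); have := mulr_ge0 (ltW e0) a0; nra.
rewrite ge0_integralD//; last 2 first.
  - by move=> u _; rewrite lee_fin mulr_ge0 ?sqr_ge0 ?ltW.
  - by move=> u _; rewrite lee_fin invr_ge0 ltW.
rewrite integral_cst//.
have leb : lebesgue_measure (`[s, t] : set R) = (t - s)%:E.
  by rewrite lebesgue_measure_itv/= lte_fin st EFinB.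
rewrite [X in (_ * X)%E]leb -EFinM (mulrC e^-1) EFinD leeD//.
under eq_integral do rewrite EFinM.
rewrite ge0_integralZl//; last 3 first.
  - by apply/measurable_EFinP; exact: measurable_funX.
  - by move=> u _; rewrite lee_fin sqr_ge0.
  - by rewrite lee_fin ltW.
rewrite EFinM fineK// lee_pmul2l ?lte_fin//.
apply: ge0_subset_integral => //; last by move=> u _; rewrite lee_fin sqr_ge0.
by apply/measurable_EFinP; exact: measurable_funX.
Qed.

Lemma AC2_loc_pos_continuous (R : realType) (X : metricType R) (gamma : R -> X)
    (t e : R) : AC2_loc_pos gamma -> 0 < t -> 0 < e ->
  \forall r \near t, mdist (gamma r) (gamma t) < e.
Proof.
move=> AC t0 e0.
have ht : t / 2 < t by lra.
have [] := @AC_on2_integral_le _ _ `]t / 2, t + 1[ gamma.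
  apply: AC; first (exists (t + 1); split=> [|M tM x /=]; first exact: num_real).
    by rewrite in_itv/= => /andP[tx xt]; rewrite gtr0_norm; lra.
  by move=> x /=; rewrite !in_itv/= => /andP[tx _]; rewrite andbT; lra.
move=> M M0 dM.
(* This parameter makes [d * M] less than [e / 2]; [M + 1] is positive even when [M] vanishes. The
   other term is below [e / 2] once the times differ by less than [d * (e / 2)]. *)
pose d := e / (2 * (M + 1)).
have M1 : 0 < M + 1 by lra.
have d0 : 0 < d by rewrite divr_gt0// mulr_gt0.
have dM2 : d * M < e / 2.
  have : d * (M + 1) = e / 2 by rewrite /d; field; rewrite gt_eqF.
  lra.
have near_t : \forall r \near t, [/\ t / 2 < r, r < t + 1 & `|r - t| < d * (e / 2)].
  near=> r; split; near: r.
  - exact: lt_nbhsr.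
  - by apply: lt_nbhsl; rewrite ltrDl.
  - have : 0 < d * (e / 2) by rewrite mulr_gt0// divr_gt0.
    by move=> p; apply/nbhs_ballP; exists (d * (e / 2)) => // y; rewrite /ball/= distrC.
apply: filterS near_t => r [tr rt rd].
have tI : t \in `]t / 2, t + 1[ by rewrite in_itv/= ht ltrDl ltr01.
have rI : r \in `]t / 2, t + 1[ by rewrite in_itv/= tr.
have small x : x <= `|r - t| -> d * M + x / d < e.
  move=> xrt; have : x / d < e / 2 by rewrite ltr_pdivrMr// mulrC (le_lt_trans xrt).
  lra.
have [rt'|tr'|->] := ltgtP r t; last by rewrite mdistxx.
- apply: le_lt_trans (dM d _ _ d0 rI tI rt') (small _ _).
  by rewrite distrC ler_norm.
- rewrite metric_sym; apply: le_lt_trans (dM d _ _ d0 tI rI tr') (small _ _).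
  by rewrite ler_norm.
Unshelve. all: by end_near. Qed.

Lemma AC2_loc_pos_cvg_mdist2 (R : realType) (X : metricType R) (gamma : R -> X)
    (x : X) (t : R) : AC2_loc_pos gamma -> 0 < t ->
  mdist (gamma r) x ^+ 2 @[r --> t] --> mdist (gamma t) x ^+ 2.
Proof.
move=> AC t0.
suff d1 : mdist (gamma r) x @[r --> t] --> mdist (gamma t) x.
  by rewrite expr2; under eq_fun do rewrite expr2; exact: cvgM.
apply/cvgrPdist_lt => e e0.
apply: filterS (AC2_loc_pos_continuous AC t0 e0) => r re.
apply: le_lt_trans re; rewrite ler_norml.
have := metric_triangle (gamma t) (gamma r) x.
have := metric_triangle (gamma r) (gamma t) x.
rewrite (metric_sym (gamma t) (gamma r)) => ? ?; lra.
Qed.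

(** * Distance increments controlled by energy increments *)

(* Here [a], [b] are the values of psi at times [s < t], [h = t - s],
   [D = d(gamma_s, gamma_t)] and [ds], [dt] are the distances to the minimizer.
   If [a >= 2 b], or if [lambda * h > 1], then [a + b] is bounded by a multiple
   of [a - b] and the growth bounds suffice. Otherwise [h * b <= D / sqrt lambda],
   which is inserted into [D ^+ 2 <= 2 * (a ^+ 2 - b ^+ 2) * h]. *)
Lemma lojasiewicz_increment (R : realType) (lambda k h a b D ds dt : R) :
  0 < lambda -> 0 < k -> lambda * k ^+ 2 = 2 -> 0 < h -> 0 <= b -> b <= a ->
  0 <= D -> 0 <= dt -> 0 <= ds -> ds <= k * a -> dt <= k * b ->
  D <= ds + dt -> ds <= dt + D ->
  D ^+ 2 <= 2 * (a ^+ 2 - b ^+ 2) * h ->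
  (2 * b ^+ 2 + lambda * dt ^+ 2) * h <= ds ^+ 2 - dt ^+ 2 ->
  D <= 13 * k * (a - b).
Proof.
move=> l0 k0 lk h0 b0 ba D0 dt0 ds0 dsa dtb Dst dsD D2 dissip.
have Dk : D <= k * (a + b) by lra.
have [ab2|ab2] := leP (2 * b) a.
  by apply: (le_trans Dk); rewrite [13 * k]mulrC -mulrA ler_pM2l//; lra.
have b_gt0 : 0 < b by lra.
set w := a ^+ 2 - b ^+ 2 in D2.
(* In this regime [a < 2 * b], so [a + b <= 3 * b]. *)
have w_le : w <= 3 * (b * (a - b)).
  by rewrite /w subr_sqr mulrC mulrCA mulrA ler_wpM2r ?subr_ge0//; lra.
have w0 : 0 <= w by rewrite /w subr_ge0 ler_sqr// nnegrE; lra.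
pose q := lambda * h.
have q0 : 0 < q by rewrite mulr_gt0.
(* Insert [ds <= dt + D] into the dissipation bound and multiply by [q]; the terms in [dt] disappear
   on completing the square [(q * dt - D) ^+ 2]. *)
have slope : 2 * (q * (h * b ^+ 2)) <= D ^+ 2 * (1 + q).
  have ds2 : ds ^+ 2 <= (dt + D) ^+ 2 by rewrite ler_sqr// nnegrE; lra.
  have := ler_wpM2l (ltW q0) (le_trans dissip (lerB ds2 (lexx _))).
  have := sqr_ge0 (q * dt - D); rewrite /q; nra.
have [q1|q1] := leP q 1.
  have hb : lambda * (h * b) ^+ 2 <= D ^+ 2.
    have : D ^+ 2 * q <= D ^+ 2 * 1 by rewrite ler_wpM2l ?sqr_ge0.
    move: slope; rewrite /q exprMn; lra.
  (* Squaring [D ^+ 2 <= 2 * w * h] and using [hb] to remove [h] leaves a common factor [D ^+ 2],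
     which cancels unless [D = 0]. *)
  have lbD : lambda * (b * D) ^+ 2 <= (2 * w) ^+ 2.
    move: D0; rewrite le_eqVlt => /predU1P[<-|D0].
      by rewrite mulr0 expr0n mulr0 sqr_ge0.
    have D20 : 0 < D ^+ 2 by rewrite exprn_gt0.
    rewrite -(ler_pM2r D20).
    have D4 : D ^+ 2 * D ^+ 2 <= (2 * w * h) * (2 * w * h) by rewrite ler_pM ?sqr_ge0.
    apply: (@le_trans _ _ (lambda * b ^+ 2 * ((2 * w * h) * (2 * w * h)))).
      rewrite [leLHS](_ : _ = lambda * b ^+ 2 * (D ^+ 2 * D ^+ 2)); last by ring.
      by rewrite ler_wpM2l// mulr_ge0 ?sqr_ge0// ltW.
    rewrite [leLHS](_ : _ = (2 * w) ^+ 2 * (lambda * (h * b) ^+ 2)); last by ring.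
    by rewrite ler_wpM2l ?sqr_ge0.
  have lD : lambda * D ^+ 2 <= (6 * (a - b)) ^+ 2.
    have b20 : 0 < b ^+ 2 by rewrite exprn_gt0.
    rewrite -(ler_pM2r b20).
    rewrite [leLHS](_ : _ = lambda * (b * D) ^+ 2); last by ring.
    apply: (le_trans lbD); rewrite -exprMn ler_sqr ?nnegrE; last 2 first.
    - by rewrite mulr_ge0.
    - by rewrite !mulr_ge0// ?subr_ge0.
    - lra.
  rewrite -ler_sqr ?nnegrE// ?mulr_ge0 ?subr_ge0 ?(ltW k0)//.
  have k20 : 0 < k ^+ 2 by rewrite exprn_gt0.
  have : 2 * D ^+ 2 <= k ^+ 2 * (6 * (a - b)) ^+ 2.
    by rewrite -lk [lambda * _]mulrC -mulrA ler_pM2l.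
  have : 0 <= k ^+ 2 * (a - b) ^+ 2 by rewrite mulr_ge0 ?sqr_ge0.
  rewrite !exprMn; lra.
(* Now [q > 1], so [1 + q <= 2 * q] and the factor [2 * q] cancels in [slope]. *)
have b2D : h * b ^+ 2 <= D ^+ 2.
  rewrite -(ler_pM2l q0).
  have : D ^+ 2 * (1 + q) <= D ^+ 2 * (2 * q) by rewrite ler_wpM2l ?sqr_ge0//; lra.
  lra.
have b2w : b ^+ 2 <= 2 * w by rewrite -(ler_pM2l h0); lra.
(* Hence [a <= 7 * (a - b)] and [a + b <= 13 * (a - b)]: this case dictates the constant 13. *)
have b6 : b <= 6 * (a - b) by rewrite -(ler_pM2l b_gt0) -expr2; lra.
by apply: (le_trans Dk); rewrite [13 * k]mulrC -mulrA ler_pM2l//; lra.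
Qed.

(* [psi] may jump. With the hitting time [T u] of [{psi <= u}], the curve
   [gamma (T u)] waits during the jumps and stays [C]-Lipschitz, because
   [psi > u] just before [T u] and [psi <= u] just after it. *)
Lemma monotone_reparametrization (R : realType) (X : metricType R)
    (gamma : R -> X) (psi : R -> R) (y ystar : X) (C L : R) :
  0 <= C -> 0 < L ->
  (forall t, 0 < t -> 0 <= psi t <= L) ->
  (forall s t, 0 < s -> s <= t -> psi t <= psi s) ->
  (forall eps : R, 0 < eps -> exists2 t, 0 < t & psi t <= eps) ->
  (forall t eps : R, 0 < t -> 0 < eps ->
    \forall r \near t, mdist (gamma r) (gamma t) < eps) ->
  (forall eps : R, 0 < eps -> \forall r \near 0^'+, mdist (gamma r) y < eps) ->
  (forall s t, 0 < s -> s <= t ->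
    mdist (gamma s) (gamma t) <= C * (psi s - psi t)) ->
  (forall t, 0 < t -> mdist (gamma t) ystar <= C * psi t) ->
  exists c : R -> X, [/\ c 0 = ystar, c L = y,
    (forall u, [\/ c u = ystar, c u = y | exists2 t, 0 < t & c u = gamma t]) &
    forall u v, mdist (c u) (c v) <= C * `|u - v| ].
Proof.
move=> C0 L0 psiL psi_ni psi_small gammac gamma0 dpsi dstar.
pose S u := [set t | 0 < t /\ psi t <= u].
pose T u := inf (S u).
(* The hitting time may be 0, where the starting point [y] replaces [gamma]. For [u <= 0] the set
   [S u] may be empty, so [c] is set to [ystar] there. *)
pose g t := if t <= 0 then y else gamma t.
pose c u := if u <= 0 then ystar else g (T u).
have lbS u : has_lbound (S u) by exists 0 => t [/ltW].
have infS u : 0 < u -> has_inf (S u).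
  by move=> /psi_small[t t0 tu]; split; [exists t|].
have T_ge0 u : 0 < u -> 0 <= T u.
  by move=> u0; apply: lb_le_inf; [exact: (infS _ u0).1|move=> t [/ltW]].
have afterT u t : 0 < u -> T u < t -> psi t <= u.
  move=> u0 Tt; have tT0 : 0 < t - T u by rewrite subr_gt0.
  have [r [r0 ru]] := inf_adherent tT0 (infS _ u0).
  by rewrite addrC subrK => rt; apply: le_trans ru; exact: psi_ni (ltW rt).
have beforeT u t : 0 < t -> t < T u -> u < psi t.
  by move=> t0 tT; rewrite ltNge; apply/negP => tu; move: tT; rewrite ltNge ge_inf.
have T_ni u v : 0 < u -> u <= v -> T v <= T u.
  move=> u0 uv; apply: lb_le_inf; first exact: (infS _ u0).1.
  by move=> t [t0 tu]; apply: ge_inf => //; split => //; exact: le_trans uv.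
have gr (t eps : R) : 0 <= t -> 0 < eps -> \forall r \near t^'+, mdist (gamma r) (g t) < eps.
  rewrite /g le_eqVlt => /predU1P[<- eps0|t0 eps0]; first by rewrite lexx; exact: gamma0.
  by rewrite leNgt t0/=; apply: cvg_within; exact: gammac.
have gl (t eps : R) : 0 < t -> 0 < eps -> \forall r \near t^'-, mdist (gamma r) (g t) < eps.
  by move=> t0 eps0; rewrite /g leNgt t0/=; apply: cvg_within; exact: gammac.
have lip u v : u <= v -> mdist (c u) (c v) <= C * (v - u).
  move=> uv; rewrite /c; have [v0|v0] := leP v 0.
    by rewrite (le_trans uv v0) mdistxx mulr_ge0// subr_ge0.
  apply/ler_addgt0Pr => eps eps0; have eps20 : 0 < eps / 2 by lra.
  (* If [u <= 0 < v], a time just after [T v] has [psi <= v], and [dstar] bounds its distance to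
     [ystar]. *)
  have [u0|u0] := leP u 0.
    have : \forall s \near (T v)^'+, T v < s /\ mdist (gamma s) (g (T v)) < eps.
      by near=> s; split; near: s; [exact: nbhs_right_gt|exact: gr (T_ge0 _ v0) _].
    move=> /filter_ex[s [Ts ds]].
    have s0 : 0 < s by rewrite (le_lt_trans _ Ts)// T_ge0.
    have := metric_triangle ystar (gamma s) (g (T v)).
    rewrite (metric_sym ystar (gamma s)); have := dstar _ s0.
    have := ler_wpM2l C0 (afterT _ _ v0 Ts).
    have : C * v <= C * (v - u) by rewrite ler_wpM2l//; lra.
    lra.
  have := T_ni _ _ u0 uv; rewrite le_eqVlt => /predU1P[->|Tvu].
    by rewrite mdistxx addr_ge0// ?mulr_ge0 ?subr_ge0// ltW.
  (* The midpoint keeps the approximating times ordered: [s] just after [T v], [t] just before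
     [T u], with [s <= t]. There [psi s <= v] and [psi t > u]. *)
  pose m := (T v + T u) / 2.
  have : \forall s \near (T v)^'+,
      [/\ T v < s, s < m & mdist (gamma s) (g (T v)) < eps / 2].
    near=> s; split; near: s; [exact: nbhs_right_gt| |exact: gr (T_ge0 _ v0) _].
    by apply: nbhs_right_lt; rewrite /m; lra.
  move=> /filter_ex[s [Ts sm ds]].
  have Tu0 : 0 < T u by rewrite (le_lt_trans _ Tvu)// T_ge0.
  have : \forall t \near (T u)^'-,
      [/\ t < T u, m < t & mdist (gamma t) (g (T u)) < eps / 2].
    near=> t; split; near: t; [exact: nbhs_left_lt| |exact: gl].
    by apply: nbhs_left_gt; rewrite /m; lra.
  move=> /filter_ex[t [tT mt dt]].
  have s0 : 0 < s by rewrite (le_lt_trans _ Ts)// T_ge0.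
  have st : s <= t by lra.
  have := metric_triangle (g (T u)) (gamma t) (g (T v)).
  have := metric_triangle (gamma t) (gamma s) (g (T v)).
  rewrite (metric_sym (g (T u)) (gamma t)) (metric_sym (gamma t) (gamma s)).
  have := dpsi _ _ s0 st.
  have : C * (psi s - psi t) <= C * (v - u).
    rewrite ler_wpM2l//; apply: lerB; first exact: afterT.
    by apply/ltW/beforeT => //; rewrite (lt_le_trans s0).
  lra.
exists c; split.
- by rewrite /c lexx.
(* Every positive time lies in [S L], so the hitting time of level [L] is 0. *)
- rewrite /c leNgt L0/= /g (_ : T L <= 0)//.
  apply/ler_addgt0Pr => eps eps0; rewrite add0r; apply: ge_inf => //.
  by split => //; case/andP: (psiL _ eps0).
- move=> u; rewrite /c; case: leP => _; first exact: Or31.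
  by rewrite /g; case: leP => T0; [exact: Or32|apply: Or33; exists (T u)].
- move=> u v; have [uv|/ltW vu] := leP u v; first by rewrite distrC ger0_norm ?subr_ge0// lip.
  by rewrite metric_sym ger0_norm ?subr_ge0// lip.
Unshelve. all: by end_near. Qed.

(** * EVI flows *)

Section EVI.
Context {R : realType} {X : metricType R}.
Variables (lambda : R) (E : X -> \bar R).
Hypotheses (lambda_gt0 : 0 < lambda) (E_gtNy : forall x, (-oo < E x)%E).

Lemma edom_fin_num x : edom E x -> E x \is a fin_num.
Proof. by move=> Ex; rewrite fin_numE gt_eqF//= lt_eqF. Qed.

Section flow.
Variable gamma : R -> X.
Hypothesis flow : EVI_flow lambda E gamma.

Let e t := fine (E (gamma t)).

Lemma EVI_edom t : 0 < t -> edom E (gamma t).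
Proof.
by move=> t0; case: flow => _ _ /(_ _ t0) + _; rewrite fin_numElt => /andP[].
Qed.

Lemma EVI_upper_right_derivative x t : edom E x -> 0 < t ->
  (upper_right_derivative (fun s => mdist (gamma s) x ^+ 2)%R t <=
   (2 * (fine (E x) - e t) - lambda * mdist (gamma t) x ^+ 2)%R%:E)%E.
Proof.
move=> Ex t0; case: flow => _ _ _ /(_ x t Ex t0).
rewrite -(fineK (edom_fin_num Ex)) -(fineK (edom_fin_num (EVI_edom t0))).
rewrite -EFinB; case: upper_right_derivative => [d| |]; last by rewrite leNye.
- rewrite -EFinM -EFinD !lee_fin -/(e t) => ?; lra.
- by rewrite gt0_muley ?lte_fin ?invr_gt0// addye// leye_eq.
Qed.

(** Integrated EVI. The rate bound [K] is left free because the later uses estimate the energy and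
    the [lambda] term differently. *)
Lemma EVI_mdist2_le x s t K : edom E x -> 0 < s -> s <= t ->
  (forall r, s <= r < t ->
    2 * (fine (E x) - e r) - lambda * mdist (gamma r) x ^+ 2 <= K) ->
  mdist (gamma t) x ^+ 2 - mdist (gamma s) x ^+ 2 <= K * (t - s).
Proof.
move=> Ex s0 st dK; case: (flow) => AC _ _ _.
apply: (@dini_le R (fun r => mdist (gamma r) x ^+ 2)) => //.
- by move=> c /andP[sc _]; apply: AC2_loc_pos_cvg_mdist2 => //; lra.
- move=> c sct; apply: (le_trans (EVI_upper_right_derivative Ex _)).
    by case/andP: sct => *; lra.
  by rewrite lee_fin dK.
Qed.

Lemma EVI_energy_nonincreasing s t : 0 < s -> s <= t -> e t <= e s.
Proof.
move=> s0 st; case: (flow) => AC lsc _ _.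
apply: (@real_induction R (fun r => e r <= e s) s t) => //
  [c /andP[sc _] cl|c /andP[sc ct] ces].
- rewrite leNgt; apply/negP => sc'; have c0 : 0 < c by lra.
  have [|V] := lsc c (e s).
    by rewrite /= -(fineK (edom_fin_num (EVI_edom c0))) lte_fin.
  (* Lower semicontinuity is relative to the positive times; as [c] is positive, the neighbourhood
     is transferred to the real line, where it contains a point of the induction hypothesis. *)
  rewrite /nbhs/= -nbhs_subspace_in; last by rewrite /= in_itv/= c0.
  rewrite withinE/= => -[W Wc VW] VE.
  have : \forall r \near c, 0 < r /\ W r.
    by near=> r; split; near: r => //; exact: lt_nbhsr.
  move=> /nbhs_ballP[d /= d0 cd].
  have [r /andP[cr rc] er] := cl _ d0.
  have [|r0 Wr] := cd r; first by rewrite /ball/= ger0_norm ?subr_ge0//; lra.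
  have : (W `&` `]0, +oo[%classic) r by split => //=; rewrite in_itv/= r0.
  rewrite -VW => -[/VE + _]; rewrite /= -(fineK (edom_fin_num (EVI_edom r0))).
  by rewrite lte_fin ltNge er.
- (* otherwise EVI tested at [gamma c] makes the flow constant on [c, t] *)
  apply: contrapT => noP.
  have c0 : 0 < c by lra.
  have above r : c <= r -> r <= t -> e c <= e r.
    rewrite le_eqVlt => /predU1P[->//|cr rt]; rewrite leNgt; apply/negP => rc.
    by apply: noP; exists r; [rewrite cr|lra].
  have := @EVI_mdist2_le (gamma c) c t 0 (EVI_edom c0) c0 (ltW ct).
  rewrite mdistxx expr0n subr0 mul0r => H.
  have /H dt : forall r, c <= r < t ->
    2 * (e c - e r) - lambda * mdist (gamma r) (gamma c) ^+ 2 <= 0.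
    move=> r /andP[cr rt]; have := above _ cr (ltW rt).
    have := mulr_ge0 (ltW lambda_gt0) (sqr_ge0 (mdist (gamma r) (gamma c))); lra.
  have /mdist_positivity tc : mdist (gamma t) (gamma c) = 0.
    by apply/eqP; rewrite -sqrf_eq0 eq_le dt sqr_ge0.
  by apply: noP; exists t; [rewrite ct lexx|rewrite /e tc].
Unshelve. all: by end_near. Qed.

(** The final energy [e t] is the least on [[s, t]], and the [lambda] term has a favourable sign and
    is dropped. *)
Lemma EVI_mdist2_energy x s t : edom E x -> 0 < s -> s <= t ->
  mdist (gamma t) x ^+ 2 - mdist (gamma s) x ^+ 2 <=
  2 * (fine (E x) - e t) * (t - s).
Proof.
move=> Ex s0 st; apply: EVI_mdist2_le => // r /andP[sr rt].
have : e t <= e r by apply: EVI_energy_nonincreasing; lra.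
have := mulr_ge0 (ltW lambda_gt0) (sqr_ge0 (mdist (gamma r) x)); lra.
Qed.

Lemma EVI_mdist2_cvg0 y : mdist (gamma t) y @[t --> 0^'+] --> (0 : R) ->
  forall d, 0 < d -> \forall t \near 0^'+, mdist (gamma t) y ^+ 2 < d.
Proof.
move=> gy d d0.
have : mdist (gamma t) y ^+ 2 @[t --> 0^'+] --> (0 : R) ^+ 2.
  by rewrite expr2; under eq_fun do rewrite expr2; exact: cvgM.
by rewrite expr0n => /cvgr_lt; exact.
Qed.

(** If [e t] exceeded the energy of [y], the integrated EVI tested at [y] would keep
    [mdist (gamma s) y ^+ 2] above [(e t - fine (E y)) * t] for [s < t / 2], against convergence to
    [y]. *)
Lemma EVI_energy_le_start y t : edom E y ->
  mdist (gamma t) y @[t --> 0^'+] --> (0 : R) -> 0 < t -> e t <= fine (E y).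
Proof.
move=> Ey gy t0; rewrite leNgt -subr_gt0; apply/negP => lt_yt.
have d0 : 0 < (e t - fine (E y)) * t by rewrite mulr_gt0.
have : \forall s \near 0^'+,
    [/\ 0 < s, s < t / 2 & mdist (gamma s) y ^+ 2 < (e t - fine (E y)) * t].
  near=> s; split; near: s; [exact: nbhs_right_gt| |exact: EVI_mdist2_cvg0].
  by apply: nbhs_right_lt; lra.
move=> /filter_ex[s [s0 st ds]].
have st' : s <= t by lra.
have := EVI_mdist2_energy Ey s0 st'; have := sqr_ge0 (mdist (gamma t) y).
have : (e t - fine (E y)) * (t / 2) <= (e t - fine (E y)) * (t - s).
  by rewrite ler_pM2l//; lra.
rewrite -/(e _); lra.
Unshelve. all: by end_near. Qed.

(** Tested at a minimizer, the EVI makes the distance to it nonincreasing in time, and this distance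
    tends to 0 at time 0. *)
Lemma EVI_from_minimizer ystar : edom E ystar ->
  (forall x, edom E x -> fine (E ystar) <= fine (E x)) ->
  mdist (gamma t) ystar @[t --> 0^'+] --> (0 : R) ->
  forall t, 0 < t -> gamma t = ystar.
Proof.
move=> Estar minE gstar t t0; apply: mdist_positivity.
apply/eqP; rewrite -sqrf_eq0 eq_le sqr_ge0 andbT leNgt; apply/negP => dt0.
have : \forall s \near 0^'+,
    [/\ 0 < s, s < t & mdist (gamma s) ystar ^+ 2 < mdist (gamma t) ystar ^+ 2].
  near=> s; split; near: s; [exact: nbhs_right_gt| |exact: EVI_mdist2_cvg0].
  exact: nbhs_right_lt.
move=> /filter_ex[s [s0 st]]; apply/negP; rewrite -leNgt -subr_le0.
have := EVI_mdist2_energy Estar s0 (ltW st).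
have : (fine (E ystar) - e t) * (t - s) <= 0.
  apply: mulr_le0_ge0; last by rewrite subr_ge0 ltW.
  by rewrite subr_le0; exact/minE/EVI_edom.
lra.
Unshelve. all: by end_near. Qed.

(** For a constant flow the distance increment in the integrated EVI vanishes, so the rate must be
    nonnegative. The times 1 and 2 are arbitrary. *)
Lemma EVI_constant_growth ystar x : (forall t, 0 < t -> gamma t = ystar) ->
  edom E x ->
  lambda * mdist x ystar ^+ 2 <= 2 * (fine (E x) - fine (E ystar)).
Proof.
move=> gstar Ex.
have : mdist (gamma 2) x ^+ 2 - mdist (gamma 1) x ^+ 2 <=
    (2 * (fine (E x) - fine (E ystar)) - lambda * mdist x ystar ^+ 2) * (2 - 1).
  apply: EVI_mdist2_le => //; first by rewrite ler1n.
  by move=> r /andP[r1 _]; rewrite /e gstar ?(lt_le_trans _ r1)// (metric_sym ystar).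
rewrite !gstar//; lra.
Qed.

(** * Flows under quadratic growth around a minimizer *)

Variable ystar : X.
Hypotheses (Estar : edom E ystar)
  (minE : forall x, edom E x -> fine (E ystar) <= fine (E x))
  (growth : forall x, edom E x ->
    lambda * mdist x ystar ^+ 2 <= 2 * (fine (E x) - fine (E ystar))).

Let psi t := Num.sqrt (e t - fine (E ystar)).

Lemma EVI_psi2 t : 0 < t -> psi t ^+ 2 = e t - fine (E ystar).
Proof. by move=> t0; rewrite sqr_sqrtr// subr_ge0; exact/minE/EVI_edom. Qed.

(** Energy and distance to [ystar] both decrease in time, so the rate at each earlier time [r] is at
    most its value at [t]; this retains the [lambda] term. *)
Lemma EVI_dissipation s t : 0 < s -> s <= t ->
  (2 * psi t ^+ 2 + lambda * mdist (gamma t) ystar ^+ 2) * (t - s) <=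
  mdist (gamma s) ystar ^+ 2 - mdist (gamma t) ystar ^+ 2.
Proof.
move=> s0 st; have t0 : 0 < t by lra.
rewrite EVI_psi2//.
suff : mdist (gamma t) ystar ^+ 2 - mdist (gamma s) ystar ^+ 2 <=
    (2 * (fine (E ystar) - e t) - lambda * mdist (gamma t) ystar ^+ 2) * (t - s).
  lra.
apply: EVI_mdist2_le => // r /andP[sr rt]; have r0 : 0 < r by lra.
have : e t <= e r by apply: EVI_energy_nonincreasing => //; exact: ltW.
have := EVI_mdist2_energy Estar r0 (ltW rt).
have : (fine (E ystar) - e t) * (t - r) <= 0.
  apply: mulr_le0_ge0; last by rewrite subr_ge0 ltW.
  by rewrite subr_le0; exact/minE/EVI_edom.
move=> ? ? ?.
have : lambda * mdist (gamma t) ystar ^+ 2 <= lambda * mdist (gamma r) ystar ^+ 2.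
  by rewrite ler_pM2l//; lra.
lra.
Qed.

Lemma EVI_psi_small eps : 0 < eps -> exists2 t, 0 < t & psi t <= eps.
Proof.
move=> eps0; pose d2 := mdist (gamma 1) ystar ^+ 2.
have d20 : 0 <= d2 by exact: sqr_ge0.
have eps20 : 0 < eps ^+ 2 by rewrite exprn_gt0.
have h0 : 0 <= d2 / eps ^+ 2 by rewrite divr_ge0// ltW.
(* Dissipation on [[1, 1 + h]] gives [2 * h * psi (1 + h) ^+ 2 <= d2], and [h * eps ^+ 2] exceeds
   [d2]. The summand 1 keeps [h] positive when [d2 = 0]. *)
pose h := d2 / eps ^+ 2 + 1.
have h1 : h * eps ^+ 2 = d2 + eps ^+ 2 by rewrite mulrDl mul1r divfK ?gt_eqF.
exists (1 + h); first by rewrite /h; lra.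
rewrite -ler_sqr ?nnegrE ?sqrtr_ge0 ?(ltW eps0)//.
have h_gt0 : 0 < h by rewrite /h; lra.
rewrite -(ler_pM2l h_gt0) h1.
have := @EVI_dissipation 1 (1 + h) ltr01; rewrite lerDl (ltW h_gt0) => /(_ isT).
rewrite [1 + h]addrC addrK -/d2.
have : 0 <= mdist (gamma (h + 1)) ystar ^+ 2 by exact: sqr_ge0.
have : 0 <= lambda * mdist (gamma (h + 1)) ystar ^+ 2 * h.
  by apply: mulr_ge0; [apply: mulr_ge0; [exact: ltW|exact: sqr_ge0]|exact: ltW].
have : 0 <= h * psi (h + 1) ^+ 2 by apply: mulr_ge0; [exact: ltW|exact: sqr_ge0].
lra.
Qed.

Let k := Num.sqrt (2 / lambda).

Lemma EVI_mdist_minimizer t : 0 < t -> mdist (gamma t) ystar <= k * psi t.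
Proof.
move=> t0; have := growth (EVI_edom t0); rewrite -/(e t) -EVI_psi2// => H.
have l2 : 0 <= 2 / lambda by rewrite divr_ge0// ltW.
rewrite -ler_sqr ?nnegrE ?mulr_ge0 ?sqrtr_ge0 ?mdist_ge0// exprMn [k ^+ 2]sqr_sqrtr//.
by rewrite mulrAC ler_pdivlMr// mulrC.
Qed.

Lemma EVI_mdist_psi s t : 0 < s -> s <= t ->
  mdist (gamma s) (gamma t) <= 13 * k * (psi s - psi t).
Proof.
move=> s0; rewrite le_eqVlt => /predU1P[<-|st].
  by rewrite mdistxx subrr mulr0.
have t0 : 0 < t by lra.
have l2 : 0 < 2 / lambda by rewrite divr_gt0.
apply: (@lojasiewicz_increment _ lambda k (t - s) _ _ _
  (mdist (gamma s) ystar) (mdist (gamma t) ystar));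
  rewrite ?mdist_ge0 ?sqrtr_ge0//.
- by rewrite sqrtr_gt0.
- by rewrite sqr_sqrtr ?ltW// mulrC divfK ?gt_eqF.
- by rewrite subr_gt0.
- by rewrite ler_wsqrtr// lerB// EVI_energy_nonincreasing// ltW.
- exact: EVI_mdist_minimizer.
- exact: EVI_mdist_minimizer.
- by rewrite (metric_sym (gamma t)) metric_triangle.
- by rewrite addrC metric_triangle.
- rewrite !EVI_psi2//; have := EVI_mdist2_energy (EVI_edom s0) s0 (ltW st).
  by rewrite mdistxx expr0n subr0 -/(e s) metric_sym opprB addrA subrK.
- exact: EVI_dissipation (ltW st).
Qed.

Lemma EVI_curve_to_minimizer y : edom E y ->
  mdist (gamma t) y @[t --> 0^'+] --> (0 : R) ->
  exists2 L, 0 <= L & exists c : R -> X, [/\ c 0 = ystar, c L = y,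
    (forall u, [\/ c u = ystar, c u = y | exists2 t, 0 < t & c u = gamma t]) &
    forall u v, mdist (c u) (c v) <= 13 * k * `|u - v| ].
Proof.
(* Adding 1 makes the parameter length positive even when [y] has minimal energy; the curve rests at
   [y] on the surplus. *)
move=> Ey gy; exists (Num.sqrt (fine (E y) - fine (E ystar)) + 1).
  by rewrite addr_ge0// sqrtr_ge0.
have k0 : 0 <= k by exact: sqrtr_ge0.
apply: (@monotone_reparametrization _ _ gamma psi).
- by rewrite mulr_ge0.
- by rewrite ltr_pwDr// sqrtr_ge0.
- move=> t t0; rewrite sqrtr_ge0/= ler_wpDr// ler_wsqrtr// lerB//.
  exact: EVI_energy_le_start.
- by move=> s t s0 st; rewrite ler_wsqrtr// lerB// EVI_energy_nonincreasing.
- exact: EVI_psi_small.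
- by move=> t eps t0 eps0; case: flow => AC _ _ _; exact: AC2_loc_pos_continuous.
- by move=> eps eps0; exact: cvgr_lt gy _ eps0.
- exact: EVI_mdist_psi.
- move=> t t0; apply: (le_trans (EVI_mdist_minimizer t0)).
  by rewrite -mulrA ler_peMl ?mulr_ge0 ?sqrtr_ge0// ler1n.
Qed.

End flow.
End EVI.

(** * Length of Lipschitz curves *)

Lemma lipschitz_AC1 (R : realType) (X : metricType R) (gamma : R -> X) (K : R) :
  (forall s t, mdist (gamma s) (gamma t) <= K * `|s - t|) ->
  AC_on 1%E `[0, 1] gamma.
Proof.
move=> lip; exists (cst K); split.
  apply/Lfun1_integrable.
  rewrite (_ : EFin \o _ = (fun u => K%:E) \_ `[0, 1]).
    apply/integrable_restrict => //; rewrite setTI.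
    apply: (@measurable_bounded_integrable _ _ _ _ (cst K)) => //.
    - by rewrite /= lebesgue_measure_itv/= lte_fin ltr01 sube0 ltry.
    - by exists `|K|; split=> [|M KM u _]; [exact: num_real|exact: ltW].
  by apply/funext => u; rewrite /= !patchE; case: ifP.
move=> s t _ _ st; rewrite (integral_cst _ _ K%:E)//.
have leb : lebesgue_measure (`[s, t] : set R) = (t - s)%:E.
  by rewrite lebesgue_measure_itv/= lte_fin st EFinB.
rewrite [X in (_ * X)%E]leb -EFinM lee_fin.
by rewrite (le_trans (lip _ _))// distrC gtr0_norm ?subr_gt0.
Qed.

Lemma lipschitz_metric_derivative (R : realType) (X : metricType R)
    (gamma : R -> X) (I : interval R) (K : R) : 0 <= K ->
  (forall s t, mdist (gamma s) (gamma t) <= K * `|s - t|) ->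
  forall t, (metric_derivative I gamma t <= K%:E)%E.
Proof.
move=> K0 lip t; rewrite /metric_derivative limf_esupE.
apply: (@le_trans _ _ (ereal_sup
    ((fun s => (mdist (gamma s) (gamma t) / `|s - t|)%:E) @` setT))).
  by apply: ereal_inf_lbound; exists setT => //; exact: filterT.
apply: ge_ereal_sup => _ [s _ <-]; rewrite lee_fin.
(* The supremum over the whole line includes [s = t], where the quotient is 0 by the convention for
   division by zero, hence at most [K]. *)
have [->|st] := eqVneq s t; first by rewrite subrr normr0 invr0 mulr0.
by rewrite ler_pdivrMr ?lip// normr_gt0 subr_eq0.
Qed.

(* No measurability of [f] is needed: only the supremum over the simple
   functions below its positive part has to be bounded. *)
Lemma integral_le_cst d (T : measurableType d) (R : realType)
    (mu : {measure set T -> \bar R}) (D : set T) (f : T -> \bar R) (K : R) :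
  measurable D -> 0 <= K -> (forall x, (f x <= K%:E)%E) ->
  (\int[mu]_(x in D) f x <= K%:E * mu D)%E.
Proof.
move=> mD K0 fK; rewrite -integral_cst// integralE.
apply: (@le_trans _ _ (\int[mu]_(x in D) f^\+ x)%E).
  by rewrite geeDl// leeNl oppe0 integral_ge0.
have fpK x : (f^\+ x <= K%:E)%E by rewrite funeposE ge_max fK lee_fin.
rewrite !ge0_integralE//.
apply: ereal_sup_le => _ [h hf <-]; exists h => // x.
apply: (le_trans (hf x)); rewrite !patchE; case: ifP => // _; exact: fpK.
Qed.

Lemma length_dist_lipschitz (R : realType) (X : metricType R) (Y : set X)
    (c : R -> X) (a b C : R) : 0 <= C -> a <= b ->
  (forall u, Y (c u)) ->
  (forall u v, mdist (c u) (c v) <= C * `|u - v|) ->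
  (length_dist Y (c a) (c b) < +oo)%E.
Proof.
move=> C0 ab cY lip; pose gamma t := c (a + t * (b - a)).
have gl s t : mdist (gamma s) (gamma t) <= C * (b - a) * `|s - t|.
  apply: (le_trans (lip _ _)); rewrite opprD addrACA subrr add0r -mulrBl normrM.
  by rewrite [ `|b - a| ]ger0_norm ?subr_ge0// -mulrA [_ * (b - a)]mulrC.
have K0 : 0 <= C * (b - a) by rewrite mulr_ge0// subr_ge0.
apply: (@le_lt_trans _ _ (\int[lebesgue_measure]_(t in `[0%R, 1%R])
    metric_derivative `[0%R, 1%R] gamma t)%E).
  apply: ereal_inf_lbound; exists gamma => //; split.
  - exact: lipschitz_AC1 gl.
  - by move=> t _; exact: cY.
  - by rewrite /gamma mul0r addr0.
  - by rewrite /gamma mul1r addrC subrK.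
apply: le_lt_trans (integral_le_cst _ _ K0 _) _.
- exact: measurable_itv.
- exact: lipschitz_metric_derivative.
- rewrite [X in (_ * X)%E](_ : _ = 1%:E) ?mule1 ?ltry//.
  by rewrite /= lebesgue_measure_itv/= lte_fin ltr01 sube0.
Qed.

Lemma length_dist_glue (R : realType) (X : metricType R) (Y : set X)
    (c1 c2 : R -> X) (L1 L2 C : R) : 0 <= C -> 0 <= L1 -> 0 <= L2 ->
  (forall u, Y (c1 u)) -> (forall u, Y (c2 u)) -> c1 0 = c2 0 ->
  (forall u v, mdist (c1 u) (c1 v) <= C * `|u - v|) ->
  (forall u v, mdist (c2 u) (c2 v) <= C * `|u - v|) ->
  (length_dist Y (c1 L1) (c2 L2) < +oo)%E.
Proof.
move=> C0 L10 L20 Y1 Y2 c12 lip1 lip2.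
(* The first curve is run backwards on the negative half-line; across 0 the triangle inequality
   through the common point preserves the constant [C]. *)
pose c u := if u <= 0 then c1 (- u) else c2 u.
have c_ge0 u : 0 <= u -> c u = c2 u.
  rewrite le_eqVlt => /predU1P[<-|u0]; rewrite /c; first by rewrite lexx oppr0.
  by rewrite leNgt u0.
have -> : c1 L1 = c (- L1) by rewrite /c oppr_le0 L10 opprK.
have -> : c2 L2 = c L2 by rewrite c_ge0.
have lip u v : u <= v -> mdist (c u) (c v) <= C * `|u - v|.
  move=> uv; have [v0|v0] := leP v 0.
    rewrite /c v0 (le_trans uv v0); apply: (le_trans (lip1 _ _)).
    by rewrite opprK addrC distrC.
  rewrite (c_ge0 v (ltW v0)); have [u0|u0] := leP 0 u; first by rewrite c_ge0 ?lip2.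
  rewrite /c (ltW u0); apply: (le_trans (metric_triangle _ (c2 0) _)).
  have := lip1 (- u) 0; have := lip2 0 v; rewrite -c12 subr0 sub0r.
  rewrite normrN (gtr0_norm v0) gtr0_norm ?oppr_gt0//.
  rewrite distrC ger0_norm ?subr_ge0//; lra.
apply: (@length_dist_lipschitz _ _ _ _ _ _ C) => //; first by lra.
- by move=> u; rewrite /c; case: ifP.
- by move=> u v; have [/lip//|/ltW/lip] := leP u v; rewrite metric_sym distrC.
Qed.

(** * Connecting two points through the minimizer *)

Local Open Scope ereal_scope.

Theorem proposition3p5 (R : realType) (X : completeMetricType R)
    (lambda : R) (lambda_gt0 : (0 < lambda)%R)
    (E : X -> \bar R) (E_gtNy : forall x, -oo < E x)
    (E_bounded_below : exists c : R, forall x, c%:E <= E x)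
    (E_proper : edom E !=set0)
    (Y : set X)
    (flow : forall y, Y y -> edom E y ->
      exists gamma : R -> X,
        [/\ EVI_flow lambda E gamma,
            flow_starts_from E gamma y &
            forall t : R, (0 < t)%R -> Y (gamma t)])
    (minimizer : exists2 ystar, Y ystar & E ystar = ereal_inf (range E)) :
  forall y1 y2, Y y1 -> edom E y1 -> Y y2 -> edom E y2 ->
    length_dist Y y1 y2 < +oo.
Proof.
move=> y1 y2 Yy1 Ey1 Yy2 Ey2.
have [ystar Ystar Estar_inf] := minimizer.
have leE x : E ystar <= E x.
  by rewrite Estar_inf; apply: ereal_inf_lbound; exists x.
have Estar : edom E ystar by exact: le_lt_trans (leE y1) Ey1.
have minE x : edom E x -> (fine (E ystar) <= fine (E x))%R.
  by move=> Ex; apply: fine_le; rewrite ?edom_fin_num.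
(* The flow from the minimizer serves only to obtain the quadratic growth of [E]. *)
have [gstar [fstar [gstar0 _] _]] := flow _ Ystar Estar.
have growth x := @EVI_constant_growth _ _ _ _ E_gtNy _ fstar _ x
  (EVI_from_minimizer lambda_gt0 E_gtNy fstar Estar minE gstar0).
have curve y : Y y -> edom E y -> exists2 L : R, (0 <= L)%R &
    exists c : R -> X, [/\ c 0%R = ystar, c L = y, forall u, Y (c u) &
      forall u v, (mdist (c u) (c v) <=
        13 * Num.sqrt (2 / lambda) * `|u - v|)%R].
  move=> Yy Ey; have [gamma [fgamma [gamma0 _] Ygamma]] := flow _ Yy Ey.
  have [L L0 [c [c0 cL cY lip]]] := EVI_curve_to_minimizer lambda_gt0 E_gtNy
    fgamma Estar minE growth Ey gamma0.
  exists L => //; exists c; split=> // u.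
  by case: (cY u) => [->|->|[t t0 ->]] //; exact: Ygamma.
have [L1 L10 [c1 [c10 <- Y1 lip1]]] := curve _ Yy1 Ey1.
have [L2 L20 [c2 [c20 <- Y2 lip2]]] := curve _ Yy2 Ey2.
by apply: length_dist_glue lip1 lip2; rewrite ?c10 ?mulr_ge0// sqrtr_ge0.
Qed.
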